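(* Let $\chi,\check\phi$ be formulas over $\vec{x}$ and $\vec{a}:\mathbb{Z}^d\to\mathbb{Z}^d$, with $\chi(\vec{x})\equiv\bigwedge_{i=1}^k C_i$ where each clause $C_i$ contains a literal $\mathit{expr}_i(\vec{x})>0$ such that for all $\vec{x}\in\mathbb{Z}^d$: $\check\phi(\vec{x})\land\mathit{expr}_i(\vec{x})\le\mathit{expr}_i(\vec{a}(\vec{x}))\implies\mathit{expr}_i(\vec{a}(\vec{x}))\le\mathit{expr}_i(\vec{a}^2(\vec{x}))$. Then the conditional acceleration technique $(\langle\chi,\vec{a}\rangle,\check\phi)\mapsto\vec{x}'=\vec{a}^n(\vec{x})\land\bigwedge_{i=1}^k 0<\mathit{expr}_i(\vec{x})\le\mathit{expr}_i(\vec{a}(\vec{x}))$ is sound; that is, for all $\vec{x},\vec{x}'\in\mathbb{Z}^d$ and $n>0$, if $\vec{x}\longrightarrow^n_{\langle\check\phi,\vec{a}\rangle}\vec{x}'$ and this formula holds, then $\vec{x}\longrightarrow^n_{\langle\chi,\vec{a}\rangle}\vec{x}'$.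
   Context: $\vec{x}=(x_1,\dots,x_d)$ ranges over $\mathbb{Z}^d$, $n$ is a variable, $\vec{x}'=(x_1',\dots,x_d')$. Formulas are finite quantifier-free propositional formulas in CNF with atoms $p>0$, $p$ a closed-form arithmetic expression. For a formula $\phi$ over $\vec{x}$ and $\vec{a}:\mathbb{Z}^d\to\mathbb{Z}^d$, the loop $\langle\phi,\vec{a}\rangle$ induces $\vec{x}\longrightarrow_{\langle\phi,\vec{a}\rangle}\vec{x}'$ iff $\phi(\vec{x})\land\vec{x}'=\vec{a}(\vec{x})$; $\longrightarrow^n$ is its $n$-fold composition and $\vec{a}^n$ the $n$-fold application of $\vec{a}$ ($\vec{a}^0=\mathrm{id}$). A conditional acceleration technique is a partial function $\mathit{accel}$ mapping pairs (loop $\langle\chi,\vec{a}\rangle$, formula $\check\phi$) to formulas over $(\vec{x},n,\vec{x}')$; it is sound if for all arguments in its domain, $\vec{x},\vec{x}'\in\mathbb{Z}^d$, $n>0$: $\vec{x}\longrightarrow^n_{\langle\check\phi,\vec{a}\rangle}\vec{x}'\land\mathit{accel}(\langle\chi,\vec{a}\rangle,\check\phi)$ implies $\vec{x}\longrightarrow^n_{\langle\chi,\vec{a}\rangle}\vec{x}'$. *)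

(* Defs.v *)
From Stdlib Require List.
From mathcomp Require Import all_boot all_order all_algebra.
From mathcomp Require Import boolp.
Set Implicit Arguments. Unset Strict Implicit. Unset Printing Implicit Defensive.
Import Order.TTheory GRing.Theory Num.Theory.
Local Open Scope ring_scope.

Notation vec d := 'rV[int]_d.

(* There is no fixed language of closed-form expressions: an expression is
   represented by the function that it denotes, from valuations of its variables
   (of type V) to an arbitrary ordered ring R.  Any concrete expression language
   with total semantics in R is an instance. *)
Definition expression (R : realDomainType) (V : Type) : Type := V -> R.

Inductive literal (R : realDomainType) (V : Type) : Type :=
  | Pos of expression R V   (* p > 0 *)
  | Neg of expression R V.  (* not (p > 0) *)

Definition clause (R : realDomainType) (V : Type) : Type := seq (literal R V).
Definition formula (R : realDomainType) (V : Type) : Type := seq (clause R V).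

Definition sat_literal (R : realDomainType) (V : Type)
    (l : literal R V) (v : V) : bool :=
  match l with Pos p => 0 < p v | Neg p => ~~ (0 < p v) end.

Definition sat_clause (R : realDomainType) (V : Type)
    (c : clause R V) (v : V) : bool := has (fun l => sat_literal l v) c.

Definition sat (R : realDomainType) (V : Type)
    (phi : formula R V) (v : V) : bool := all (fun c => sat_clause c v) phi.

Definition conj_clauses (R : realDomainType) (V : Type) (k : nat)
    (C : 'I_k -> clause R V) : formula R V := [seq C i | i <- enum 'I_k].

Record loop (R : realDomainType) (d : nat) : Type := Loop {
  guard : formula R (vec d);
  update : vec d -> vec d
}.

Definition step (R : realDomainType) (d : nat) (L : loop R d)
    (x x' : vec d) : Prop := sat (guard L) x /\ x' = update L x.

Fixpoint steps (R : realDomainType) (d : nat) (L : loop R d) (n : nat)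
    (x x' : vec d) : Prop :=
  if n is m.+1 then exists2 y, step L x y & steps L m y x' else x = x'.

(* Valuations of (x, n, x'). *)
Notation trace_vars d := (vec d * nat * vec d)%type.

(* Partial functions are encoded with option. *)
Definition accel_technique (R : realDomainType) (d : nat) : Type :=
  loop R d -> formula R (vec d) -> option (formula R (trace_vars d)).

Definition sound (R : realDomainType) (d : nat)
    (accel : accel_technique R d) : Prop :=
  forall (chi : formula R (vec d)) (a : vec d -> vec d)
         (phi : formula R (vec d)) (psi : formula R (trace_vars d)),
    accel (Loop chi a) phi = Some psi ->
    forall (x x' : vec d) (n : nat), (0 < n)%N ->
      steps (Loop phi a) n x x' -> sat psi (x, n, x') ->
      steps (Loop chi a) n x x'.

(* The conjunction of x' = a^n(x) and of 0 < expr_i(x) <= expr_i(a(x)) for all i.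
   Every atom being of the form p > 0, an inequality p <= q is written
   not (p - q > 0), and an equality is a conjunction of two inequalities. *)
Definition increase_formula (R : realDomainType) (d : nat) (a : vec d -> vec d)
    (k : nat) (expr : 'I_k -> expression R (vec d)) :
    formula R (trace_vars d) :=
  [seq [:: Neg (fun v : trace_vars d =>
             (v.2 0 j)%:~R - (iter v.1.2 a v.1.1 0 j)%:~R : R)]
     | j <- enum 'I_d] ++
  [seq [:: Neg (fun v : trace_vars d =>
             (iter v.1.2 a v.1.1 0 j)%:~R - (v.2 0 j)%:~R : R)]
     | j <- enum 'I_d] ++
  [seq [:: Pos (fun v : trace_vars d => expr i v.1.1)] | i <- enum 'I_k] ++
  [seq [:: Neg (fun v : trace_vars d => expr i v.1.1 - expr i (a v.1.1))]
     | i <- enum 'I_k].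

Lemma sat_increase_formula (R : realDomainType) (d : nat) (a : vec d -> vec d)
    (k : nat) (expr : 'I_k -> expression R (vec d))
    (x : vec d) (n : nat) (x' : vec d) :
  sat (increase_formula a expr) (x, n, x') <->
  x' = iter n a x /\ forall i, 0 < expr i x <= expr i (a x).
Proof.
have memE (T : finType) (t : T) : t \in Finite.enum T by rewrite -enumT mem_enum.
rewrite /sat /increase_formula !all_cat !all_map; split.
  case/and4P=> /allP le1 /allP le2 /allP pos /allP incr; split.
    apply/rowP=> j; apply/eqP; rewrite eq_le.
    have:= le1 j (memE _ _); have:= le2 j (memE _ _).
    by rewrite /= /sat_clause /= !orbF -!leNgt !subr_le0 !ler_int => -> ->.
  move=> i; have:= pos i (memE _ _); have:= incr i (memE _ _).
  by rewrite /= /sat_clause /= !orbF -!leNgt !subr_le0 => -> ->.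
case=> -> incr; apply/and4P; split; apply/allP=> i _;
  rewrite /= /sat_clause /= orbF ?subrr ?ltxx //.
  by case/andP: (incr i).
by rewrite -leNgt subr_le0; case/andP: (incr i).
Qed.

(* Clauses C_1, ..., C_k together with the selected expr_1, ..., expr_k. *)
Record selection (R : realDomainType) (d : nat) : Type := Selection {
  sel_size : nat;
  sel_clause : 'I_sel_size -> clause R (vec d);
  sel_expr : 'I_sel_size -> expression R (vec d)
}.

(* List.In rather than \in, as literals have no decidable equality. *)
Definition applicable (R : realDomainType) (d : nat)
    (chi : formula R (vec d)) (a : vec d -> vec d) (phi : formula R (vec d))
    (k : nat) (C : 'I_k -> clause R (vec d))
    (expr : 'I_k -> expression R (vec d)) : Prop :=
  [/\ forall x, sat chi x = sat (conj_clauses C) x,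
      forall i, List.In (Pos (expr i)) (C i)
    & forall i x, sat phi x -> expr i x <= expr i (a x) ->
        expr i (a x) <= expr i (a (a x))].

(* The clauses and literals used for a given loop and formula are not unique;
   the technique is parametrized by the way they are chosen, and is undefined
   where the chosen ones do not meet the requirements. *)
Definition accel_increase (R : realDomainType) (d : nat)
    (select : loop R d -> formula R (vec d) -> selection R d) :
    accel_technique R d :=
  fun L phi =>
    let s := select L phi in
    if `[< applicable (guard L) (update L) phi
             (@sel_clause _ _ s) (@sel_expr _ _ s) >]
    then Some (increase_formula (update L) (@sel_expr _ _ s))
    else None.

(* Main.v *)
Require Import Defs.
From Stdlib Require List.
From mathcomp Require Import all_boot all_order all_algebra.
From mathcomp Require Import boolp.
Import Order.TTheory GRing.Theory Num.Theory.
Local Open Scope ring_scope.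

(** The condition [0 < expr_i x <= expr_i (a x)] is an invariant of the
    [phi]-guarded iteration: [phi] at [x] turns monotonicity at [x] into
    monotonicity at [a x], and positivity propagates by transitivity.  It entails
    [chi], since it makes one literal of each clause true. *)

Lemma sat_clause_Pos (R : realDomainType) (V : Type) (p : expression R V)
    (c : clause R V) (v : V) :
  List.In (Pos p) c -> 0 < p v -> sat_clause c v.
Proof.
move=> + p_gt0; elim: c => //= l c IHc [->|/IHc c_v]; rewrite /sat_clause /=.
  by rewrite p_gt0.
by apply/orP; right.
Qed.

Lemma sat_conj_clauses (R : realDomainType) (V : Type) (k : nat)
    (C : 'I_k -> clause R V) (v : V) :
  (forall i, sat_clause (C i) v) -> sat (conj_clauses C) v.
Proof. by move=> C_v; rewrite /sat all_map; apply/allP => i _; apply: C_v. Qed.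

(** Both loops share the update [a], so they visit the same states and only the guard has to be
    exchanged at each of them. The induction on [n] keeps [x] general, because peeling off the first
    step moves the invariant to [a x]. *)
Lemma steps_increase (R : realDomainType) (d : nat)
    (chi phi : formula R (vec d)) (a : vec d -> vec d)
    (k : nat) (C : 'I_k -> clause R (vec d))
    (expr : 'I_k -> expression R (vec d)) (n : nat) (x x' : vec d) :
  applicable chi a phi C expr ->
  (forall i, 0 < expr i x <= expr i (a x)) ->
  steps (Loop phi a) n x x' -> steps (Loop chi a) n x x'.
Proof.
case=> chiE expr_in expr_incr.
elim: n x => [//|n IHn] x incr_x [_ [/= phi_x ->] phi_steps].
exists (a x).
  split=> //=; rewrite chiE; apply: sat_conj_clauses => i.
  by apply: sat_clause_Pos (expr_in i) _; case/andP: (incr_x i).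
(* Using [phi] at [x] alone gives the invariant at [a x], even if [a x] is the final state, where
   [phi] may fail. *)
apply: IHn phi_steps => i; have /andP[expr_gt0 expr_le] := incr_x i.
by rewrite (lt_le_trans expr_gt0 expr_le) expr_incr.
Qed.

(** Any [select] will do: a result [Some psi] certifies that the selected clauses and literals
    passed the [applicable] test. *)
Lemma accel_increase_sound (R : realDomainType) (d : nat)
    (select : loop R d -> formula R (vec d) -> selection R d) :
  sound (accel_increase select).
Proof.
move=> chi a phi psi; rewrite /accel_increase.
case: asboolP => // appl [<-] x x' n _ phi_steps.
by case/sat_increase_formula=> _ incr_x; apply: steps_increase appl incr_x _.
Qed.

Theorem theorem13 (R : realDomainType) (d : nat)
    (chi phi : formula R (vec d)) (a : vec d -> vec d)
    (k : nat) (C : 'I_k -> clause R (vec d))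
    (expr : 'I_k -> expression R (vec d))
    (chi_clauses : forall x, sat chi x = sat (conj_clauses C) x)
    (expr_literal : forall i, List.In (Pos (expr i)) (C i))
    (expr_increase : forall i x,
       sat phi x -> expr i x <= expr i (a x) ->
       expr i (a x) <= expr i (a (a x))) :
  (forall select : loop R d -> formula R (vec d) -> selection R d,
     select (Loop chi a) phi = Selection C expr ->
     accel_increase select (Loop chi a) phi = Some (increase_formula a expr) /\
     sound (accel_increase select)) /\
  (forall (x x' : vec d) (n : nat), (0 < n)%N ->
     steps (Loop phi a) n x x' ->
     x' = iter n a x /\ (forall i, 0 < expr i x <= expr i (a x)) ->
     steps (Loop chi a) n x x').
Proof.
have appl : applicable chi a phi C expr by [].
split=> [select selectE | x x' n _ phi_steps [_ incr_x]].
  split; last exact: accel_increase_sound.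
  (* Once the projections of [Selection C expr] reduce, the domain test is exactly [appl]. *)
  by rewrite /accel_increase selectE /= asboolT.
exact: steps_increase appl incr_x phi_steps.
Qed.
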